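(* Let $0<q<1$. For every nonnegative integer $k$ and every real $\varphi$, $$h_{2k}(\sinh\varphi\,|\,q)=(-1)^k q^{-k^2}\,(q;q^2)_k\; D_k^{(q^{-1})}\big(e^{2\varphi}+e^{-2\varphi}\,\big|\,q\big)$$ and $$h_{2k+1}(\sinh\varphi\,|\,q)=(-1)^k q^{-k(k+1)}\,(q^3;q^2)_k\,(2\sinh\varphi)\; D_k^{(q)}\big(qe^{2\varphi}+qe^{-2\varphi}\,\big|\,q\big).$$
   Context: Notation: $(a;p)_n=\prod_{j=0}^{n-1}(1-ap^j)$ with $(a;p)_0=1$. The $q^{-1}$-Hermite polynomials $h_n(x|q)$ are the polynomials in $x$ determined by $$h_n(\sinh\varphi\,|\,q)=\sum_{k=0}^n\frac{(-1)^k q^{k(k-n)}(q;q)_n}{(q;q)_k(q;q)_{n-k}}\,e^{\varphi(n-2k)}.$$ The dual discrete $q$-ultraspherical polynomials with parameter $s>0$ are the polynomials $D_n^{(s)}(y|q)$ in $y$ such that, with $\mu(x;s)=q^{-x}+sq^{x+1}$, $$D_n^{(s)}(\mu(x;s)|q)={}_3\phi_2\big(q^{-x},\,sq^{x+1},\,q^{-n};\ \sqrt{s}\,q,\,-\sqrt{s}\,q;\ q,\,-q^{n+1}\big),$$ where ${}_3\phi_2(a_1,a_2,a_3;b_1,b_2;q,z)=\sum_{k\ge 0}\frac{(a_1;q)_k(a_2;q)_k(a_3;q)_k}{(b_1;q)_k(b_2;q)_k}\frac{z^k}{(q;q)_k}$. Explicitly, as a polynomial in $y$, $$D_n^{(s)}(y|q)=\sum_{k=0}^n\frac{(q^{-n};q)_k\,\prod_{j=0}^{k-1}\big(1+sq^{2j+1}-q^j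 y\big)}{(sq^2;q^2)_k\,(q;q)_k}\,(-q^{n+1})^k .$$ *)

(* Defs.v *)
From HB Require Import structures.
From mathcomp Require Import all_boot all_order all_algebra ring lra zify.
From mathcomp Require Import all_classical all_reals all_analysis.
Set Implicit Arguments.
Unset Strict Implicit.
Unset Printing Implicit Defensive.
Import Order.TTheory GRing.Theory Num.Theory.
Import numFieldNormedType.Exports.
Local Open Scope classical_set_scope.
Local Open Scope ring_scope.

Definition sinhR (R : realType) (phi : R) : R := (expR phi - expR (- phi)) / 2.

Definition qpoch (R : realType) (a p : R) (n : nat) : R :=
  \prod_(j < n) (1 - a * p ^+ j).

(* The exponent k (k - n) is a (nonpositive) integer: [^] is the power with
   exponent in [int]. *)
Definition hermite_sum (R : realType) (q : R) (n : nat) (phi : R) : R :=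
  \sum_(k < n.+1)
    (-1) ^+ k * q ^ (k%:Z * (k%:Z - n%:Z)) * qpoch q q n
      / (qpoch q q k * qpoch q q (n - k)%N)
    * expR (phi * (n%:R - 2 * k%:R)).

Definition is_hermite (R : realType) (q : R) (n : nat) (p : {poly R}) : Prop :=
  forall phi : R, p.[sinhR phi] = hermite_sum q n phi.

(* h_n(x|q) is the polynomial determined by [is_hermite q n]; the default value
   0 is never used, see [hermiteP] and [is_hermite_unique]. *)
Definition hermite (R : realType) (q : R) (n : nat) : {poly R} :=
  xget 0 [set p : {poly R} | is_hermite q n p].

(* D_n^{(s)}(y|q) as a polynomial in y; [dual_ultraE] recovers the
   basic hypergeometric form. *)
Definition dual_ultra (R : realType) (s q : R) (n : nat) : {poly R} :=
  \sum_(k < n.+1)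
    (qpoch (q ^- n) q k / (qpoch (s * q ^+ 2) (q ^+ 2) k * qpoch q q k)
       * (- q ^+ n.+1) ^+ k)
    *: \prod_(j < k) ((1 + s * q ^+ (2 * j + 1)%N)%:P - q ^+ j *: 'X).

Definition phi32 (R : realType) (a1 a2 a3 b1 b2 q z : R) : R :=
  limn (series (fun k : nat =>
    qpoch a1 q k * qpoch a2 q k * qpoch a3 q k / (qpoch b1 q k * qpoch b2 q k)
      * (z ^+ k / qpoch q q k))).

Section Facts.
Variable R : realType.
Implicit Types (q s phi : R) (n k : nat).

Lemma sinhR_ln (x : R) : 0 < x -> sinhR (ln x) = (x - x^-1) / 2.
Proof. by move=> x0; rewrite /sinhR expRN lnK. Qed.

Lemma is_hermite_unique q n (p r : {poly R}) :
  is_hermite q n p -> is_hermite q n r -> p = r.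
Proof.
move=> hp hr; apply/eqP; rewrite -subr_eq0; apply/eqP.
pose f (i : nat) : R := sinhR (ln i.+1%:R).
apply: (@roots_geq_poly_eq0 _ _ [seq f i | i <- iota 0 (size (p - r))]).
- apply/allP => _ /mapP[i _ ->].
  by rewrite rootE hornerD hornerN hp hr subrr.
- have lin (a b c d : R) : (a - c) / 2 = (b - d) / 2 -> a - b + (d - c) = 0.
    by move=> e; lra.
  rewrite map_inj_uniq ?iota_uniq // => i j.
  rewrite /f !sinhR_ln ?ltr0n //.
  set a : R := i.+1%:R; set b : R := j.+1%:R => e.
  have a0 : 0 < a by rewrite ltr0n.
  have b0 : 0 < b by rewrite ltr0n.
  have /eqP : (a - b) * (1 + (a * b)^-1) = 0.
    rewrite mulrDr mulr1 (_ : (a - b) * (a * b)^-1 = b^-1 - a^-1); last first.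
      by field; rewrite !gt_eqF.
    exact: lin e.
  rewrite mulf_eq0 subr_eq0 => /orP[|].
    by rewrite eqr_nat => /eqP[].
  by rewrite gt_eqF // addr_gt0 // invr_gt0 mulr_gt0.
- by rewrite size_map size_iota.
Qed.

(* Polynomials P_m with P_m(sinh phi) = e^{m phi} + (-1)^m e^{-m phi}. *)
Lemma exp_pair_poly (m : nat) : exists p : {poly R}, forall phi,
  p.[sinhR phi] = expR (phi * m%:R) + (-1) ^+ m * expR (- (phi * m%:R)).
Proof.
pose P i (p : {poly R}) := forall phi,
  p.[sinhR phi] = expR (phi * i%:R) + (-1) ^+ i * expR (- (phi * i%:R)).
suff [] : (exists p, P m p) /\ (exists p, P m.+1 p) by [].
elim: m => [|m [[p Pp] [r Pr]]].
  split; first by exists 2%:P => phi; rewrite hornerC !mulr0 oppr0 expR0; lra.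
  by exists (2 *: 'X) => phi; rewrite hornerZ hornerX !mulr1 /sinhR; lra.
split; first by exists r.
exists ((2 *: 'X) * r + p) => phi.
rewrite hornerD hornerM hornerZ hornerX Pr Pp /sinhR.
rewrite -(natr1 m.+1) -(natr1 m) !mulrDr !mulr1.
rewrite !opprD !expRD !exprS.
have e1 : expR phi * expR (- phi) = 1 by rewrite expRN divff // expR_eq0.
set a := expR phi in e1 *; set b := expR (- phi) in e1 *.
set c := expR _; set d := expR _; set t := _ ^+ m.
transitivity (c * (a * a) + t * d * (b * b) + (c + t * d) * (1 - a * b)).
  have -> : 2 * ((a - b) / 2) = a - b by field.
  ring.
by rewrite e1; ring.
Qed.

Lemma hermite_exists q n : exists p, is_hermite q n p.
Proof.
pose c (k : nat) : R := q ^ (k%:Z * (k%:Z - n%:Z)) * qpoch q q n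
      / (qpoch q q k * qpoch q q (n - k)).
have cs k : (k <= n)%N -> c (n - k)%N = c k.
  move=> kn; rewrite /c subKn // [qpoch q q k * _]mulrC; do 3 f_equal.
  by rewrite -subzn //; ring.
have pairE k : exists p : {poly R}, forall phi, (k <= n)%N ->
    p.[sinhR phi] = (-1) ^+ k * expR (phi * (n%:R - 2 * k%:R))
       + (-1) ^+ (n - k) * expR (- (phi * (n%:R - 2 * k%:R))).
  have [k2|k2] := leqP (2 * k) n.
    have [p hp] := exp_pair_poly (n - 2 * k); exists ((-1) ^+ k *: p) => phi kn.
    rewrite hornerZ hp natrB // natrM mulrDr mulrA -exprD.
    by congr (_ + _ ^+ _ * _); lia.
  have [p hp] := exp_pair_poly (2 * k - n); exists ((-1) ^+ (n - k) *: p) => phi kn.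
  rewrite hornerZ hp natrB ?(ltnW k2) // natrM mulrDr mulrA -exprD addrC.
  congr (_ ^+ _ * expR _ + _ * expR _); [by lia|by ring|by ring].
have [P hP] := choice pairE.
exists (\sum_(k < n.+1) (c k / 2) *: P k) => phi.
rewrite horner_sum /hermite_sum.
set S := RHS.
have S1 : S = \sum_(k < n.+1) c k * ((-1) ^+ k * expR (phi * (n%:R - 2 * k%:R))).
  by apply: eq_bigr => k _; rewrite /c; ring.
have S2 : S = \sum_(k < n.+1) c k * ((-1) ^+ (n - k)
                                     * expR (- (phi * (n%:R - 2 * k%:R)))).
  rewrite S1 (reindex_inj rev_ord_inj); apply: eq_bigr => k _ /=.
  have kn : (k <= n)%N by rewrite -ltnS.
  rewrite subSS cs // natrB //; congr (_ * (_ * expR _)); ring.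
have -> : S = (S + S) / 2 by field.
rewrite {1}S1 S2 -big_split mulr_suml; apply: eq_bigr => k _ /=.
by rewrite hornerZ hP -1?ltnS //; ring.
Qed.

Lemma hermiteP q n : is_hermite q n (hermite q n).
Proof. exact: (@xgetPex _ 0 [set p | is_hermite q n p] (hermite_exists q n)). Qed.

Lemma dual_ultraE q s (x : R) n : 0 < q < 1 -> 0 < s ->
  (dual_ultra s q n).[q `^ (- x) + s * q `^ (x + 1)] =
  phi32 (q `^ (- x)) (s * q `^ (x + 1)) (q ^- n)
        (Num.sqrt s * q) (- Num.sqrt s * q) q (- q ^+ n.+1).
Proof.
move=> /andP[q0 q1] s0; rewrite /phi32; set u := fun k : nat => _.
have u0 k : (n < k)%N -> u k = 0.
  move=> nk; rewrite /u (_ : qpoch (q ^- n) q k = 0) ?mulr0 ?mul0r //.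
  apply/eqP; rewrite prodf_seq_eq0; apply/hasP.
  exists (Ordinal nk); first by rewrite mem_index_enum.
  by rewrite /= mulVf ?subrr // expf_neq0 // gt_eqF.
have -> : limn (series u) = series u n.+1.
  apply: cvg_lim => //; apply: cvg_near_cst; exists n.+1 => // m /= nm.
  apply/eqP; rewrite !seriesEnat /= (big_cat_nat (n := n.+1)) //=.
  rewrite [X in _ + X](_ : _ = 0) ?addr0 //.
  by rewrite big_nat_cond big1 // => i /andP[/andP[ni _] _]; exact: u0.
rewrite seriesEnat /= big_mkord /dual_ultra horner_sum; apply: eq_bigr => k _.
rewrite hornerZ horner_prod /u.
have -> : qpoch (Num.sqrt s * q) q k * qpoch (- Num.sqrt s * q) q k =
          qpoch (s * q ^+ 2) (q ^+ 2) k.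
  rewrite /qpoch -big_split; apply: eq_bigr => j _ /=.
  by rewrite -[in RHS](sqr_sqrtr (ltW s0)) -exprM mulnC exprM; ring.
have -> : \prod_(j < k) ((1 + s * q ^+ (2 * j + 1)%N)%:P - q ^+ j *: 'X).[
             q `^ (- x) + s * q `^ (x + 1)] =
          qpoch (q `^ (- x)) q k * qpoch (s * q `^ (x + 1)) q k.
  rewrite /qpoch -big_split; apply: eq_bigr => j _ /=.
  have E : q `^ (- x) * q `^ (x + 1) = q.
    by rewrite -powRD ?addKr ?powRr1 ?ltW // gt_eqF // implybT.
  rewrite hornerD hornerN hornerC hornerZ hornerX exprD expr1 mulnC exprM.
  rewrite -{2}E; ring.
by rewrite invfM; ring.
Qed.

End Facts.

(* Main.v *)
Require Import Defs.
From HB Require Import structures.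
From mathcomp Require Import all_boot all_order all_algebra.
From mathcomp Require Import ring zify.
From mathcomp Require Import all_classical all_reals all_analysis.
Import Order.TTheory GRing.Theory Num.Theory.
Import numFieldNormedType.Exports.
Local Open Scope ring_scope.

(** The [h_n] satisfy [h_{n+2} = 2 x h_{n+1} - q^{-n-1} (1 - q^{n+1}) h_n], so it
    is enough that the right-hand sides satisfy the same recurrence. Put
    [Y = e^{2 phi} + e^{-2 phi}], so that [(2 sinh phi)^2 = Y - 2]. The even
    right-hand side is expanded in [B_j = prod_{i<j} (1 + q^{2i} - q^i Y)] and the
    odd one in [C_j = prod_{i<j} (1 + q^{2i+2} - q^{i+1} Y)]. Since
    [B_{j+1} = (2 - Y) C_j] and
    [q^{j+1} B_{j+1} = C_{j+1} - (1 - q^{j+1})^2 C_j], the recurrence reduces to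
    rational identities between coefficients. *)

(** * Shift rules for q-Pochhammer symbols *)

Section QPochhammer.
Variable R : realType.
Implicit Types (a p : R) (n : nat).

Lemma qpoch0 a p : qpoch a p 0 = 1.
Proof. by rewrite /qpoch big_ord0. Qed.

Lemma qpochS a p n : qpoch a p n.+1 = qpoch a p n * (1 - a * p ^+ n).
Proof. by rewrite /qpoch big_ord_recr. Qed.

Lemma qpochSl a p n : qpoch a p n.+1 = (1 - a) * qpoch (a * p) p n.
Proof.
rewrite /qpoch big_ord_recl expr0 mulr1; congr (_ * _).
by apply: eq_bigr => i _; rewrite lift0 exprS mulrA.
Qed.

Lemma qpoch_shift a p n :
  (1 - a) * qpoch (a * p) p n = qpoch a p n * (1 - a * p ^+ n).
Proof. by rewrite -qpochSl qpochS. Qed.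

End QPochhammer.

(** * Nonvanishing of the denominators for [0 < q < 1] *)

Section Recurrences.
Variables (R : realType) (q : R).
Hypothesis hq : 0 < q < 1.

Let q_neq0 : q != 0.
Proof. by case/andP: hq => q0 _; rewrite gt_eqF. Qed.

Let expq_neq0 n : q ^+ n != 0.
Proof. exact: expf_neq0. Qed.

Lemma expq_neq1 n : 1 - q ^+ n.+1 != 0.
Proof.
case/andP: hq => q0 q1; rewrite subr_eq0 eq_sym lt_eqF //.
by rewrite exprn_ilt1 // ltW.
Qed.

Lemma qpoch_exp_neq0 i j n : qpoch (q ^+ i.+1) (q ^+ j) n != 0.
Proof.
apply/prodf_neq0 => m _.
by rewrite -exprM -exprD addSn expq_neq1.
Qed.

Let qpoch_q_neq0 n : qpoch q q n != 0.
Proof. exact: (qpoch_exp_neq0 0 1). Qed.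

Let qpoch_qq_neq0 n : qpoch q (q ^+ 2) n != 0.
Proof. exact: (qpoch_exp_neq0 0 2). Qed.

Lemma qpoch_expN_eq0 n : qpoch (q ^- n) q n.+1 = 0.
Proof. by rewrite qpochS mulVf // subrr mulr0. Qed.

(** * Three-term recurrence for the q^{-1}-Hermite sums *)

Definition hermite_coef (k m : nat) : R :=
  (-1) ^+ k * q ^- (k * m) * qpoch q q (k + m) / (qpoch q q k * qpoch q q m).

(** With [m = n - k] the exponent k(k-n) is -km, so [hermite_coef] needs neither integer exponents
    nor truncated subtraction. *)
Lemma hermite_coefE n k : (k <= n)%N ->
  (-1) ^+ k * q ^ (k%:Z * (k%:Z - n%:Z)) * qpoch q q n
    / (qpoch q q k * qpoch q q (n - k)%N) = hermite_coef k (n - k).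
Proof.
move=> kn; rewrite /hermite_coef subnKC //; do 3 congr (_ * _).
have -> : k%:Z * (k%:Z - n%:Z) = - (k * (n - k))%N%:Z.
  by rewrite PoszM -subzn //; ring.
by rewrite -exprnN.
Qed.

Lemma hermite_coef0 m : hermite_coef 0 m = 1.
Proof.
by rewrite /hermite_coef mul0n add0n expr0 invr1 !mul1r qpoch0 mul1r divff.
Qed.

Lemma hermite_coefn0 k : hermite_coef k 0 = (-1) ^+ k.
Proof.
by rewrite /hermite_coef muln0 addn0 expr0 invr1 qpoch0 !mulr1 mulfK.
Qed.

(** This compares the coefficients of e^{(m-k) phi} in the recurrence for h_{n+2}, where n = k + m:
    multiplying h_{n+1} by e^phi keeps the index k+1, and multiplying it by e^{-phi} moves k to
    k+1. *)
Lemma hermite_coefSS k m :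
  hermite_coef k.+1 m.+1 = hermite_coef k.+1 m - hermite_coef k m.+1
    - q ^- (k + m).+1 * (1 - q ^+ (k + m).+1) * hermite_coef k m.
Proof.
have := expq_neq1 k; have := expq_neq1 m.
have := qpoch_q_neq0 k; have := qpoch_q_neq0 m.
have := expq_neq0 k; have := expq_neq0 m; have := expq_neq0 (k * m).
have := q_neq0.
rewrite /hermite_coef !addSn !addnS !qpochS !mulSn !mulnS.
rewrite !(exprS, exprD).
move: (qpoch q q k) (qpoch q q m) (qpoch q q (k + m)) (q ^+ (k * m)).
move: (q ^+ k) (q ^+ m) ((-1) ^+ k) => K M s A B C T *.
field.
by do ?[apply/andP; split].
Qed.

Lemma hermite_sumE n phi : hermite_sum q n phi =
  \sum_(k < n.+1) hermite_coef k (n - k) * expR (phi * (n%:R - 2 * k%:R)).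
Proof.
apply: eq_bigr => k _; rewrite -hermite_coefE //.
by rewrite -ltnS.
Qed.

Lemma hermite_sum_rec n phi : hermite_sum q n.+2 phi =
  2 * sinhR phi * hermite_sum q n.+1 phi
  - q ^- n.+1 * (1 - q ^+ n.+1) * hermite_sum q n phi.
Proof.
rewrite (_ : 2 * sinhR phi = expR phi - expR (- phi)); last first.
  by rewrite /sinhR; field.
rewrite mulrBl !hermite_sumE.
(* The two extreme exponentials of h_{n+2} come only from the first term of e^phi h_{n+1} and the
   last term of e^{-phi} h_{n+1}. The remaining n+1 terms match one by one through
   [hermite_coefSS]. *)
rewrite big_ord_recl big_ord_recr /=.
rewrite [in X in _ = expR phi * X - _ - _]big_ord_recl /=.
rewrite [in X in _ = _ - expR (- phi) * X - _]big_ord_recr /=.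
rewrite !subn0 !subnn !hermite_coef0 !hermite_coefn0 /bump /= !add1n.
rewrite (mulrDr (expR phi)) (mulrDr (expR (- phi))) !mulr_sumr !mul1r.
set f0 := expR (phi * _); set f1 := expR phi * expR _.
have -> : f1 = f0 by rewrite /f0 /f1 -expRD -!natr1; congr expR; ring.
set g0 := _ ^+ _ * _; set g1 := expR (- phi) * (_ * _).
have -> : g0 = - g1.
  rewrite /g0 /g1 mulrCA -expRD [_ ^+ n.+2]exprS mulN1r mulNr.
  by congr (- (_ * expR _)); rewrite -!natr1; ring.
set S0 := \sum_(i < _) _; set S1 := \sum_(i < _) _; set S2 := \sum_(i < _) _.
set S3 := \sum_(i < _) _.
suff -> : S0 = S1 - S2 - S3 by ring.
rewrite /S0 /S1 /S2 /S3 -!sumrB; apply: eq_bigr => k _.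
have kn : (k <= n)%N by rewrite -ltnS.
rewrite ?add1n !subSS !subSn // hermite_coefSS subnKC //.
set e := expR (phi * (n.+2%:R - _)).
have -> : expR (phi * (n%:R - 2 * k%:R)) = e.
  by rewrite /e -!natr1; congr expR; ring.
rewrite ![expR _ * (_ * _)]mulrCA -!expRD.
have -> : phi + phi * (n.+1%:R - 2 * k.+1%:R) = phi * (n.+2%:R - 2 * k.+1%:R).
  by rewrite -!natr1; ring.
have -> : - phi + phi * (n.+1%:R - 2 * k%:R) = phi * (n.+2%:R - 2 * k.+1%:R).
  by rewrite -!natr1; ring.
by rewrite -/e; ring.
Qed.

(** * Coefficients of the right-hand sides in the bases B_j and C_j *)

Definition even_coef (n j : nat) : R :=
  (-1) ^+ n * q ^- (n ^ 2)%N * qpoch q (q ^+ 2) n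
  * (qpoch (q ^- n) q j / (qpoch q (q ^+ 2) j * qpoch q q j)
     * (- q ^+ n.+1) ^+ j).

(** The prefactor is absorbed as in [even_coef], except for [2 sinh phi], which stays outside the
    sum. *)
Definition odd_coef (n j : nat) : R :=
  (-1) ^+ n * q ^- (n * (n + 1))%N * qpoch (q ^+ 3) (q ^+ 2) n
  * (qpoch (q ^- n) q j / (qpoch (q ^+ 3) (q ^+ 2) j * qpoch q q j)
     * (- q ^+ n.+1) ^+ j).

(** Lets a sum be extended by one zero term, so that sums for n and n+1 share an index range. *)
Lemma even_coef_last n : even_coef n n.+1 = 0.
Proof. by rewrite /even_coef qpoch_expN_eq0 !mul0r mulr0. Qed.

Lemma odd_coef_last n : odd_coef n n.+1 = 0.
Proof. by rewrite /odd_coef qpoch_expN_eq0 !mul0r mulr0. Qed.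

(** Expresses even and odd coefficients through the same symbol (q;q^2)_n. *)
Let qpoch_q3 n :
  qpoch (q ^+ 3) (q ^+ 2) n = qpoch q (q ^+ 2) n * (1 - q * (q ^+ n) ^+ 2) / (1 - q).
Proof.
have q1 := expq_neq1 0; rewrite expr1 in q1.
rewrite [q ^+ 3]exprS -exprM mulnC exprM -qpoch_shift; field.
exact: q1.
Qed.

Let qpoch_expN n j :
  qpoch (q ^- n.+1) q j * (1 - q ^- n.+1 * q ^+ j) =
  (1 - q ^- n.+1) * qpoch (q ^- n) q j.
Proof.
rewrite -qpoch_shift (_ : q ^- n.+1 * q = q ^- n) //.
by rewrite exprS invfM mulrAC mulVf // mul1r.
Qed.

Let expq_odd_neq1 j : 1 - q * (q ^+ j) ^+ 2 != 0.
Proof. by rewrite -exprM -exprS expq_neq1. Qed.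

Let expq_sqr n : q ^+ (n.+1 ^ 2)%N = q ^+ (n ^ 2)%N * (q ^+ n) ^+ 2 * q.
Proof. by rewrite -exprM -exprD -exprSr; congr (_ ^+ _); lia. Qed.

Let expq_mulS n : q ^+ (n * (n + 1))%N = q ^+ (n ^ 2)%N * q ^+ n.
Proof. by rewrite -exprD; congr (_ ^+ _); lia. Qed.

Let expq_double n i : q ^+ (2 * n + i) = (q ^+ n) ^+ 2 * q ^+ i.
Proof. by rewrite exprD mulnC exprM. Qed.

Let exprNq n j : (- q ^+ n.+1) ^+ j = (- q ^+ n) ^+ j * q ^+ j.
Proof. by rewrite -exprMn exprSr mulNr. Qed.

(** The odd sum does not contribute here: (Y-2) C_j = -B_{j+1} never involves B_0. *)
Lemma even_coefS0 n :
  even_coef n.+1 0 = - (q ^- (2 * n + 1) * (1 - q ^+ (2 * n + 1)) * even_coef n 0).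
Proof.
rewrite /even_coef !qpoch0 qpochS expq_sqr expq_double [(-1) ^+ n.+1]exprS.
rewrite [(q ^+ 2) ^+ n]exprAC !expr0.
have := expq_neq0 n; have := expq_neq0 (n ^ 2)%N; have := q_neq0.
move: (q ^+ n) (q ^+ (n ^ 2)%N) => N T *; field.
by do ?[apply/andP; split].
Qed.

(** Coefficient of B_{j+1} in the even recurrence; the sign of [odd_coef] comes from (Y-2) C_j =
    -B_{j+1}. *)
Lemma even_coefSS n j :
  even_coef n.+1 j.+1 = - odd_coef n j
    - q ^- (2 * n + 1) * (1 - q ^+ (2 * n + 1)) * even_coef n j.+1.
Proof.
rewrite /even_coef /odd_coef [qpoch (q ^- n.+1) q j.+1]qpochS qpoch_expN.
rewrite !qpoch_q3 !qpochS expq_sqr expq_mulS expq_double.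
rewrite [(-1) ^+ n.+1]exprS (exprNq n.+1) [(- _) ^+ j.+1]exprS.
rewrite ![(q ^+ 2) ^+ _]exprAC !exprS.
have := expq_neq0 n; have := expq_neq0 j; have := expq_neq0 (n ^ 2)%N.
have := expq_odd_neq1 j; have := expq_neq1 j; have := expq_neq1 0.
have := qpoch_q_neq0 j; have := qpoch_qq_neq0 j; have := q_neq0.
rewrite !exprS expr0 !mulr1.
(* Once all symbols are reduced to common ones, the identity is rational in them, so they can be
   treated as free variables. *)
move: (qpoch q q j) (qpoch q (q * q) j) (qpoch q (q * q) n).
move: (qpoch _ q j) ((- _) ^+ j) ((-1) ^+ n).
move: (q ^+ n) (q ^+ j) (q ^+ (n ^ 2)%N) => N J T P U s A B C *.
field.
by do ?[apply/andP; split].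
Qed.

Let qpoch_expN_pred n j : qpoch (q ^- n) q j =
  qpoch (q ^- n.+1) q j * (1 - q ^- n.+1 * q ^+ j) / (1 - q ^- n.+1).
Proof.
rewrite qpoch_expN mulrAC divff ?mul1r // subr_eq0 eq_sym invr_eq1.
by rewrite eq_sym -subr_eq0 expq_neq1.
Qed.

(** Coefficient of C_j in the odd recurrence. Rewriting B_j and B_{j+1} in the C basis makes two
    consecutive even coefficients contribute. *)
Lemma odd_coefS n j :
  odd_coef n.+1 j = q ^- j * even_coef n.+1 j
    - q ^- j.+1 * (1 - q ^+ j.+1) ^+ 2 * even_coef n.+1 j.+1
    - q ^- (2 * n + 2) * (1 - q ^+ (2 * n + 2)) * odd_coef n j.
Proof.
rewrite /even_coef /odd_coef [qpoch (q ^- n.+1) q j.+1]qpochS.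
rewrite (qpoch_expN_pred n).
rewrite !qpoch_q3 !qpochS expq_mulS expq_sqr expq_mulS expq_double.
rewrite [(-1) ^+ n.+1]exprS [(- _) ^+ j.+1]exprS (exprNq n.+1).
rewrite ![(q ^+ 2) ^+ _]exprAC.
have := expq_neq0 n; have := expq_neq0 j; have := expq_neq0 (n ^ 2)%N.
have := expq_odd_neq1 j; have := expq_neq1 j; have := expq_neq1 0.
have := qpoch_q_neq0 j; have := qpoch_qq_neq0 j; have := q_neq0.
(* Clears the denominator 1 - q^{-n-1} introduced by [qpoch_expN_pred]. *)
have : q ^+ n.+1 - 1 != 0 by rewrite -opprB oppr_eq0 expq_neq1.
rewrite !exprS expr0 !mulr1.
move: (qpoch q q j) (qpoch q (q * q) j) (qpoch q (q * q) n).
move: (qpoch _ q j) ((- _) ^+ j) ((-1) ^+ n).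
move: (q ^+ n) (q ^+ j) (q ^+ (n ^ 2)%N) => N J T P U s A B C *.
field.
by do ?[apply/andP; split].
Qed.

(** * The two bases and the recurrences for the sums *)

Variable Y : R.

Definition even_basis (j : nat) : R :=
  \prod_(i < j) (1 + q ^+ (2 * i) - q ^+ i * Y).

Definition odd_basis (j : nat) : R :=
  \prod_(i < j) (1 + q ^+ (2 * i.+1) - q ^+ i.+1 * Y).

Lemma even_basisS j : even_basis j.+1 = (2 - Y) * odd_basis j.
Proof.
rewrite /even_basis big_ord_recl /= muln0 expr0; congr (_ * _).
by rewrite mul1r.
Qed.

(** With Q = q^{j+1}, the last factor of C_{j+1} satisfies (1 + Q^2 - QY) - (1-Q)^2 = Q(2-Y). *)
Lemma even_basis_odd j :
  even_basis j.+1 =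
  q ^- j.+1 * (odd_basis j.+1 - (1 - q ^+ j.+1) ^+ 2 * odd_basis j).
Proof.
rewrite even_basisS [odd_basis j.+1]big_ord_recr /= -/(odd_basis j).
rewrite mulnC exprM; have := expq_neq0 j.+1; move: (q ^+ j.+1) => J *.
by field.
Qed.

Definition even_sum (n : nat) : R :=
  \sum_(j < n.+1) even_coef n j * even_basis j.

Definition odd_sum (n : nat) : R :=
  \sum_(j < n.+1) odd_coef n j * odd_basis j.

Lemma even_sumS n : even_sum n.+1 = (Y - 2) * odd_sum n
  - q ^- (2 * n + 1) * (1 - q ^+ (2 * n + 1)) * even_sum n.
Proof.
set c := q ^- _ * _.
have -> : even_sum n = \sum_(j < n.+2) even_coef n j * even_basis j.
  by rewrite big_ord_recr /= even_coef_last mul0r addr0.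
rewrite /even_sum big_ord_recl [X in _ - c * X]big_ord_recl even_coefS0 -/c mulrDr.
set S0 := \sum_(i < _) _; set S1 := \sum_(i < _) _.
suff -> : S0 = (Y - 2) * odd_sum n - c * S1 by ring.
rewrite /S0 /S1 /odd_sum !mulr_sumr -sumrB; apply: eq_bigr => j _.
by rewrite !lift0 even_coefSS -/c even_basisS; ring.
Qed.

Lemma odd_sumS n : odd_sum n.+1 = even_sum n.+1
  - q ^- (2 * n + 2) * (1 - q ^+ (2 * n + 2)) * odd_sum n.
Proof.
set c := q ^- _ * _.
have -> : odd_sum n = \sum_(j < n.+2) odd_coef n j * odd_basis j.
  by rewrite big_ord_recr /= odd_coef_last mul0r addr0.
(* Change of basis from B to C. The term B_0 = C_0 = 1 is split off, and the shifted coefficient at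
   j = n+1 vanishes. *)
have -> : even_sum n.+1 = \sum_(j < n.+2) (q ^- j * even_coef n.+1 j
    - q ^- j.+1 * (1 - q ^+ j.+1) ^+ 2 * even_coef n.+1 j.+1) * odd_basis j.
  under [RHS]eq_bigr do rewrite mulrBl.
  rewrite sumrB [X in _ - X]big_ord_recr /= even_coef_last mulr0 mul0r addr0.
  rewrite /even_sum big_ord_recl [X in _ = X - _]big_ord_recl /= expr0 invr1 mul1r.
  rewrite [even_basis 0]big_ord0 [odd_basis 0]big_ord0 -addrA; congr (_ + _).
  rewrite -sumrB; apply: eq_bigr => j _.
  by rewrite /bump add1n even_basis_odd; ring.
rewrite mulr_sumr -sumrB; apply: eq_bigr => j _.
by rewrite odd_coefS -/c; ring.
Qed.

(** Both parities are carried through one induction, as each step of the three-term recurrence uses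
    the previous two indices. *)
Lemma hermite_sum_even_odd phi k : (2 * sinhR phi) ^+ 2 = Y - 2 ->
  hermite_sum q (2 * k) phi = even_sum k /\
  hermite_sum q (2 * k + 1) phi = 2 * sinhR phi * odd_sum k.
Proof.
move=> hY; elim: k => [|k [IHe IHo]].
  rewrite /even_sum /odd_sum /even_coef /odd_coef /even_basis /odd_basis.
  rewrite !hermite_sumE muln0 add0n !big_ord_recl !big_ord0 /bump /=.
  rewrite !(hermite_coef0, hermite_coefn0, qpoch0, expr0, invr1, mulr1, mulr0).
  rewrite subr0 mulr0 expR0 /sinhR !expr1 !mul1r !subr0 !mulr1 !addr0.
  split=> //.
  rewrite (_ : phi * (1 - 2) = - phi); last by ring.
  by field.
have He : hermite_sum q (2 * k.+1) phi = even_sum k.+1.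
  rewrite (_ : 2 * k.+1 = (2 * k).+2)%N; last by lia.
  rewrite hermite_sum_rec -[(2 * k).+1]addn1 IHe IHo mulrA -expr2 hY.
  by rewrite even_sumS.
split=> //.
rewrite (_ : 2 * k.+1 + 1 = (2 * k + 1).+2)%N; last by lia.
rewrite hermite_sum_rec IHo (_ : (2 * k + 1).+1 = 2 * k.+1)%N; last by lia.
rewrite He odd_sumS (_ : 2 * k.+1 = 2 * k + 2)%N; last by lia.
ring.
Qed.

(** * The sums as dual q-ultraspherical polynomials, with s = 1/q, y = Y and s = q, y = qY *)

Lemma dual_ultra_even n :
  (-1) ^+ n * q ^- (n ^ 2)%N * qpoch q (q ^+ 2) n * (dual_ultra q^-1 q n).[Y]
  = even_sum n.
Proof.
rewrite /dual_ultra horner_sum mulr_sumr; apply: eq_bigr => j _.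
rewrite hornerZ horner_prod /even_coef [q^-1 * q ^+ 2]mulKf // -[RHS]mulrA.
do 2 congr (_ * _); apply: eq_bigr => i _.
by rewrite hornerD hornerN hornerC hornerZ hornerX addn1 exprS mulKf.
Qed.

Lemma dual_ultra_odd n :
  (-1) ^+ n * q ^- (n * (n + 1))%N * qpoch (q ^+ 3) (q ^+ 2) n
    * (dual_ultra q q n).[q * Y] = odd_sum n.
Proof.
rewrite /dual_ultra horner_sum mulr_sumr; apply: eq_bigr => j _.
rewrite hornerZ horner_prod /odd_coef -exprS -[RHS]mulrA.
do 2 congr (_ * _); apply: eq_bigr => i _.
rewrite hornerD hornerN hornerC hornerZ hornerX mulrA -exprSr -exprS.
by congr (1 + q ^+ _ - _); lia.
Qed.

End Recurrences.

Theorem mainTheorem1 (R : realType) (q : R) (hq : 0 < q < 1)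
    (k : nat) (phi : R) :
  (hermite q (2 * k)%N).[sinhR phi] =
    (-1) ^+ k * q ^- (k ^ 2)%N * qpoch q (q ^+ 2) k
    * (dual_ultra q^-1 q k).[expR (2 * phi) + expR (- (2 * phi))]
  /\
  (hermite q (2 * k + 1)%N).[sinhR phi] =
    (-1) ^+ k * q ^- (k * (k + 1))%N * qpoch (q ^+ 3) (q ^+ 2) k
    * (2 * sinhR phi)
    * (dual_ultra q q k).[q * expR (2 * phi) + q * expR (- (2 * phi))].
Proof.
set Y := expR (2 * phi) + _.
have hY : (2 * sinhR phi) ^+ 2 = Y - 2.
  have e : expR phi * expR (- phi) = 1 by rewrite -expRD subrr expR0.
  rewrite /Y /sinhR (_ : 2 * phi = phi + phi); last by ring.
  rewrite opprD !expRD; move: (expR phi) (expR (- phi)) e => a b e.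
  (* Writing 2 as 2ab turns the goal into the expansion of (a-b)^2. *)
  rewrite (_ : a * a + b * b - 2 = a * a + b * b - 2 * (a * b)); last by rewrite e mulr1.
  by field.
have [he ho] := hermite_sum_even_odd _ _ hq _ _ k hY.
rewrite !hermiteP he ho -mulrDr -/Y dual_ultra_even // -(dual_ultra_odd _ _ hq).
by split=> //; ring.
Qed.
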